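(* Let $a\le 0$ be an integer. Define $b_{\mathcal{M}}(n)$, $n\ge0$, by $b_{\mathcal{M}}(0)=1$, $b_{\mathcal{M}}(1)=-1$, $b_{\mathcal{M}}(2)=a$ and, for $n\ge3$, $b_{\mathcal{M}}(n)=-\frac{1}{2}\sum_{k=0}^{n-1}b_{\mathcal{M}}(k)\binom{n+1}{k+1}$. For integers $0\le j\le d$ set $s_{\mathcal{M}}(j,d)=\sum_{k=j}^d\frac{1}{k+1}\binom{d-j}{d-k}b_{\mathcal{M}}(k)$. Then for all $m\ge1$: $$0=s_{\mathcal{M}}(0,4m)\le s_{\mathcal{M}}(1,4m)\le\cdots\le s_{\mathcal{M}}(2m,4m),$$ $$0\le s_{\mathcal{M}}(2m,4m+1)\le s_{\mathcal{M}}(2m-1,4m+1)\le\cdots\le s_{\mathcal{M}}(0,4m+1),$$ $$0=s_{\mathcal{M}}(0,4m+2)\ge s_{\mathcal{M}}(1,4m+2)\ge\cdots\ge s_{\mathcal{M}}(2m+1,4m+2),$$ $$0\ge s_{\mathcal{M}}(2m+1,4m+3)\ge s_{\mathcal{M}}(2m,4m+3)\ge\cdots\ge s_{\mathcal{M}}(0,4m+3).$$ *)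

(* Defs.v *)
From mathcomp Require Import all_boot all_order all_algebra.
Set Implicit Arguments.
Unset Strict Implicit.
Unset Printing Implicit Defensive.
Import Order.TTheory GRing.Theory Num.Theory.
Local Open Scope ring_scope.

(* The sequence b is given by course-of-values recursion; [bM_seq a n] is the
   list [:: b 0; ...; b (n - 1)] and [bM_next] computes its next term. The
   defining equations are bM0, bM1, bM2 and bM_rec below. *)
Definition bM_next (a : int) (s : seq rat) : rat :=
  match size s with
  | 0%N => 1
  | 1%N => -1
  | 2%N => a%:~R
  | n => - (1 / 2) * \sum_(0 <= k < n) s`_k * 'C(n.+1, k.+1)%:R
  end.

Definition bM_seq (a : int) (n : nat) : seq rat :=
  iter n (fun s => rcons s (bM_next a s)) [::].

Definition bM (a : int) (n : nat) : rat := bM_next a (bM_seq a n).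

Definition sM (a : int) (j d : nat) : rat :=
  \sum_(j <= k < d.+1) 1 / (k.+1)%:R * 'C(d - j, d - k)%:R * bM a k.

Lemma size_bM_seq a n : size (bM_seq a n) = n.
Proof. by elim: n => //= n IHn; rewrite size_rcons IHn. Qed.

Lemma nth_bM_seq a n k : (k < n)%N -> (bM_seq a n)`_k = bM a k.
Proof.
elim: n => // n IHn; rewrite ltnS leq_eqVlt /= nth_rcons size_bM_seq.
by case: (ltngtP k n) => //= [ltkn _ | -> _]; first exact: IHn.
Qed.

Lemma bM0 a : bM a 0 = 1. Proof. by []. Qed.

Lemma bM1 a : bM a 1 = -1. Proof. by []. Qed.

Lemma bM2 a : bM a 2 = a%:~R. Proof. by []. Qed.

Lemma bM_rec a n : (3 <= n)%N ->
  bM a n = - (1 / 2) * \sum_(0 <= k < n) bM a k * 'C(n.+1, k.+1)%:R.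
Proof.
move=> n3; have -> : bM a n =
    - (1 / 2) * \sum_(0 <= k < n) (bM_seq a n)`_k * 'C(n.+1, k.+1)%:R.
  by rewrite {1}/bM /bM_next size_bM_seq; case: n n3 => [|[|[|n]]].
by congr (_ * _); apply: eq_big_nat => k /andP[_ kn]; rewrite nth_bM_seq.
Qed.

(* Main.v *)
Require Import Defs.
From mathcomp Require Import all_boot all_order all_algebra.
From mathcomp Require Import zify ring lra.
Import Order.TTheory GRing.Theory Num.Theory.
Local Open Scope ring_scope.

(** The triangle s(j,d) obeys the Pascal rule s(j,d+1) = s(j+1,d+1) + s(j,d),
    so the monotonicity of row d+1 is the constancy of sign of row d.  The
    recursion for b says that s(0,d) + s(d,d) = 0 for d >= 3, and together with
    the Pascal rule this forces the reflection s(d-j,d) = (-1)^d s(j,d).  Hence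
    an even row starts at 0, while an odd row satisfies
    2 s(h,2h+1) = s(h,2h) at its middle; the signs of the left halves of the rows
    then propagate from row 3 onwards. *)

Definition pascal_triangle (R : zmodType) (s : nat -> nat -> R) :=
  forall j d, (j <= d)%N -> s j d.+1 = s j.+1 d.+1 + s j d.

Lemma pascal_row_const (R : zmodType) (t : nat -> nat -> R) d :
    pascal_triangle R t -> (forall j, (j <= d)%N -> t j d = 0) ->
  forall j, (j <= d.+1)%N -> t j d.+1 = t 0 d.+1.
Proof.
move=> tP t0; elim=> // j IHj jd.
by rewrite -IHj 1?ltnW // (tP j) // t0 // addr0.
Qed.

(* The defect of symmetry is again a Pascal triangle, so once it vanishes on a
   row it is constant on the next one; on even rows it is moreover antisymmetric. *)
Lemma pascal_reflection (R : realFieldType) (s : nat -> nat -> R) :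
    pascal_triangle R s -> (forall d, odd d -> s 0 d + s d d = 0) ->
  forall d j, (j <= d)%N -> s (d - j)%N d = (-1) ^+ d * s j d.
Proof.
move=> sP s_odd.
pose t j d := s j d - (-1) ^+ d * s (d - j)%N d.
(* Reflection reverses the direction of differences along a row; the sign [(-1) ^+ d] compensates
   for this. *)
have tP : pascal_triangle R t.
  move=> j d jd; rewrite /t sP // subSS (subSn jd) (sP (d - j)%N d) ?leq_subr //.
  by rewrite exprS; ring.
have t0 : forall d j, (j <= d)%N -> t j d = 0.
  elim=> [|d IHd] j jd.
    by move: jd; rewrite leqn0 => /eqP->; rewrite /t subnn expr0; ring.
  rewrite (pascal_row_const R t d) //.
  have: t d.+1 d.+1 = t 0 d.+1 by apply: pascal_row_const.
  rewrite /t subnn subn0 -signr_odd.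
  case: (boolP (odd d.+1)) => [od|ev]; rewrite ?expr1 ?expr0.
    (* In an odd row [t 0 d.+1] is the sum of the two end entries of [s]. *)
    by have := s_odd _ od; lra.
  lra.
move=> d j jd; have := t0 d j jd; rewrite /t => /eqP.
rewrite subr_eq0 => /eqP->.
by rewrite mulrA -exprD addnn -signr_odd odd_double expr0 mul1r.
Qed.

Lemma pascal_sign (R : realFieldType) (s : nat -> nat -> R) :
    pascal_triangle R s ->
    (forall d j, (j <= d)%N -> s (d - j)%N d = (-1) ^+ d * s j d) ->
    (forall h, (2 <= h)%N -> s 0 h.*2 = 0) ->
    (forall j, (j <= 1)%N -> s j 3 <= 0) ->
  forall d j, (3 <= d)%N -> (j <= d./2)%N -> 0 <= (-1) ^+ d./2 * s j d.
Proof.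
move=> sP s_sym s0 s3; elim=> // d IHd j.
rewrite leq_eqVlt => /orP[/eqP[<-] /s3 | d3]; first by rewrite expr1; lra.
have := odd_double_half d; case: (boolP (odd d)) => od; rewrite ?add1n ?add0n.
  (* Passing to an even row flips the sign: from 0 at the left end, each move to the right subtracts
     an entry of row [d]. *)
  move=> dE; have hE : d.+1./2 = d./2.+1 by rewrite -dE /= doubleK uphalf_double.
  rewrite hE; elim: j => [_|j IHj jd].
    by rewrite -dE -doubleS s0 ?mulr0 //; lia.
  have := IHj (ltnW jd); have := IHd j d3 jd.
  by rewrite (sP j d) ?exprS; [lra | lia].
(* Passing to an odd row keeps the sign: entries of row [d] are added when moving left from the
   middle, hence the induction on [d./2 - j]. *)
move=> dE; have hE : d.+1./2 = d./2 by rewrite -dE /= doubleK uphalf_double.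
rewrite hE; have [n] := ubnP (d./2 - j); elim: n j => // n IHn j jn jd.
have [jh | hj] := ltnP j d./2.
  rewrite (sP j d) ?mulrDr; last by lia.
  by apply: addr_ge0; [apply: IHn | apply: IHd]; lia.
(* At the middle [h = d./2], reflection gives [s h.+1 d.+1 = - s h d.+1], so the Pascal rule reads
   [s h d = 2 * s h d.+1]. *)
have {jn jd hj} -> : j = d./2 by lia.
have hd : (d./2 <= d)%N by lia.
have := IHd d./2 d3 (leqnn _).
have := s_sym d.+1 d./2 (leqW hd); have := sP d./2 d hd.
have -> : (d.+1 - d./2 = d./2.+1)%N by lia.
rewrite -[(-1) ^+ d.+1]signr_odd /= od expr1 => sPh sE.
have -> : s d./2 d = 2 * s d./2 d.+1 by lra.
lra.
Qed.

Lemma sM_pascal a : pascal_triangle rat (sM a).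
Proof.
move=> j d jd; rewrite /sM (big_nat_recr d.+1) ?leqW //=.
(* This sum may start at [k = j], where ['C(d - j, d.+1 - j)] vanishes; Pascal's rule for binomials
   then applies term by term. *)
have -> : \sum_(j.+1 <= k < d.+2)
      1 / k.+1%:R * 'C(d.+1 - j.+1, d.+1 - k)%:R * bM a k
  = \sum_(j <= k < d.+2) 1 / k.+1%:R * 'C(d - j, d.+1 - k)%:R * bM a k.
  rewrite subSS [RHS]big_ltn ?ltnS ?leqW //.
  rewrite [in RHS]bin_small; last by rewrite subSn.
  by rewrite mulr0 mul0r add0r.
rewrite [in RHS](big_nat_recr d.+1) ?leqW //= subnn !bin0 addrAC -big_split /=.
congr (_ + _); apply: eq_big_nat => k /andP[jk kd].
by rewrite (subSn jd) (@subSn k d) // binS natrD; ring.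
Qed.

Lemma sM_diag a d : sM a d d = bM a d / d.+1%:R.
Proof. by rewrite /sM big_nat1 subnn bin0; ring. Qed.

(** Since ['C(d, k) / k.+1 = 'C(d.+1, k.+1) / d.+1], the number [d.+1 * s 0 d] is the sum of the
    recursion extended to [k = d], that is [-2 b d + b d = - b d]. *)
Lemma sM_ends a d : (3 <= d)%N -> sM a 0 d + sM a d d = 0.
Proof.
move=> d3; rewrite sM_diag.
have -> : sM a 0 d
    = (\sum_(0 <= k < d.+1) bM a k * 'C(d.+1, k.+1)%:R) / d.+1%:R.
  rewrite /sM mulr_suml; apply: eq_big_nat => k /andP[_ kd].
  rewrite subn0 bin_sub //.
  have dn0 : d.+1%:R != 0 :> rat by rewrite pnatr_eq0.
  have kn0 : k.+1%:R != 0 :> rat by rewrite pnatr_eq0.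
  have CE : 'C(d.+1, k.+1)%:R = d.+1%:R * 'C(d, k)%:R / k.+1%:R :> rat.
    by rewrite -natrM mul_bin_diag natrM mulrC mulKf.
  rewrite CE; move: d.+1%:R k.+1%:R dn0 kn0 {CE} => x y x0 y0.
  by field; rewrite x0 y0.
rewrite big_nat_recr //= binn mulr1 -mulrDl.
have := bM_rec a d3; set S := \sum_(0 <= _ < d) _ => ->.
by rewrite (_ : _ + _ + _ = 0) ?mul0r //; field.
Qed.

Lemma sM_ends_odd a d : odd d -> sM a 0 d + sM a d d = 0.
Proof.
case: d => [|[|[|d]]] // _; last exact: sM_ends.
(* Row 1 precedes the recursion and rests on the initial values: [s 0 0 + 2 * s 1 1 = 1 - 1]. *)
by rewrite sM_pascal // !sM_diag bM0 bM1; field.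
Qed.

Lemma sM_reflection a d j :
  (j <= d)%N -> sM a (d - j)%N d = (-1) ^+ d * sM a j d.
Proof. exact: pascal_reflection (sM_pascal a) (sM_ends_odd a) d j. Qed.

(** The ends of an even row are equal by reflection and, from row 3 on, opposite. Row 2 starts at
    [a / 3] instead. *)
Lemma sM0_even a h : (2 <= h)%N -> sM a 0 h.*2 = 0.
Proof.
move=> h2; have := @sM_ends a h.*2; have := @sM_reflection a h.*2 0 isT.
rewrite subn0 -signr_odd odd_double expr0 => -> sE.
by have := sE ltac:(lia); lra.
Qed.

Lemma bM3 a : bM a 3 = 1 - 2 * a%:~R.
Proof.
rewrite bM_rec // !big_nat_recr //= big_geq // bM0 bM1 bM2 bin1.
have [-> ->] : 'C(4, 2) = 6%N /\ 'C(4, 3) = 4%N by [].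
by field.
Qed.

(** Base of the sign propagation, where [a <= 0] enters: the two entries are [a / 2 - 1 / 4] and
    [a / 6 - 1 / 4]. *)
Lemma sM_row3_le0 a j : a <= 0 -> (j <= 1)%N -> sM a j 3 <= 0.
Proof.
rewrite -(ler_int rat) => a0.
have P := sM_pascal a.
have s13 : sM a 1 3 = a%:~R / 6 - 1 / 4.
  by rewrite (P 1%N 2) // (P 2%N 2) // (P 1%N 1%N) // !sM_diag bM1 bM2 bM3; field.
case: j => [|[|j]] // _; last by rewrite s13; lra.
rewrite (P 0%N 2) // s13 (P 0%N 1%N) // (P 1%N 1%N) // (P 0%N 0%N) //.
by rewrite !sM_diag bM0 bM1 bM2; lra.
Qed.

Theorem mainTheorem12 (a : int) (ha : a <= 0) (m : nat) (hm : (1 <= m)%N) :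
  (sM a 0 (4 * m) = 0 /\
   forall j : nat, (j < 2 * m)%N ->
     sM a j (4 * m) <= sM a j.+1 (4 * m)) /\
  (0 <= sM a (2 * m) (4 * m + 1) /\
   forall j : nat, (j < 2 * m)%N ->
     sM a j.+1 (4 * m + 1) <= sM a j (4 * m + 1)) /\
  (sM a 0 (4 * m + 2) = 0 /\
   forall j : nat, (j < 2 * m + 1)%N ->
     sM a j (4 * m + 2) >= sM a j.+1 (4 * m + 2)) /\
  (0 >= sM a (2 * m + 1) (4 * m + 3) /\
   forall j : nat, (j < 2 * m + 1)%N ->
     sM a j.+1 (4 * m + 3) >= sM a j (4 * m + 3)).
Proof.
have sgn := pascal_sign _ _ (sM_pascal a) (sM_reflection a) (sM0_even a)
  (fun j => sM_row3_le0 a j ha).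
have pos h d j : d./2 = h -> ~~ odd h -> (3 <= d)%N -> (j <= h)%N ->
    0 <= sM a j d.
  move=> <- /negbTE oh d3 jh.
  by have := sgn d j d3 jh; rewrite -signr_odd oh expr0 mul1r.
have neg h d j : d./2 = h -> odd h -> (3 <= d)%N -> (j <= h)%N ->
    sM a j d <= 0.
  move=> <- oh d3 jh.
  by have := sgn d j d3 jh; rewrite -signr_odd oh expr1 mulN1r oppr_ge0.
(* Each chain of inequalities in row [d] thus reduces to the sign of row [d.-1], decided by the
   parity of [d.-1./2]. *)
have diff d j : (0 < d)%N -> (j < d)%N -> sM a j d = sM a j.+1 d + sM a j d.-1.
  by case: d => // d _ jd; apply: sM_pascal.
split; [split|split; [split|split; split]].
- have -> : (4 * m = (2 * m).*2)%N by lia.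
  by apply: sM0_even; lia.
- move=> j jm; rewrite (diff (4 * m)%N j); [|lia|lia].
  by rewrite gerDl; apply: (neg (2 * m).-1); lia.
- by apply: (pos (2 * m)%N); lia.
- move=> j jm; rewrite (diff (4 * m + 1)%N j); [|lia|lia].
  by rewrite lerDl; apply: (pos (2 * m)%N); lia.
- have -> : (4 * m + 2 = (2 * m + 1).*2)%N by lia.
  by apply: sM0_even; lia.
- move=> j jm; rewrite (diff (4 * m + 2)%N j); [|lia|lia].
  by rewrite lerDl; apply: (pos (2 * m)%N); lia.
- by apply: (neg (2 * m + 1)%N); lia.
- move=> j jm; rewrite (diff (4 * m + 3)%N j); [|lia|lia].
  by rewrite gerDl; apply: (neg (2 * m + 1)%N); lia.
Qed.
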